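(* For any metric space $(X,d)$ of generalized roundness $p$ with $0<p<\infty$, there exists a metric space of generalized roundness $q>p$ that is both uniformly and coarsely equivalent to $(X,d)$.
   Context: The generalized roundness $\mathfrak{q}(X)\in[0,\infty]$ of a metric space $(X,d)$ is the supremum of the set of all $p\geq 0$ such that for all integers $n\geq 2$ and all (not necessarily distinct) points $x_1,\dots,x_n,y_1,\dots,y_n\in X$, $$\sum_{1\leq i<j\leq n}\{d(x_i,x_j)^p+d(y_i,y_j)^p\}\leq\sum_{1\leq i,j\leq n}d(x_i,y_j)^p.$$ A uniform equivalence between metric spaces is a bijection that is uniformly continuous with uniformly continuous inverse. A map $f:(X,d)\to(Y,\varsigma)$ is a coarse embedding if there exist non-decreasing functions $\rho_1,\rho_2:[0,\infty)\to[0,\infty)$ with $\rho_1(d(x,y))\leq\varsigma(f(x),f(y))\leq\rho_2(d(x,y))$ for all $x,y\in X$ and $\lim_{t\to\infty}\rho_1(t)=\infty$; it is a coarse equivalence if in addition there is $C\ge 0$ such that every point of $Y$ is within distance $C$ of $f(X)$. *)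

(* Defs.v *)
From HB Require Import structures.
From mathcomp Require Import all_boot all_order all_algebra.
From mathcomp Require Import all_classical all_reals all_analysis.

Set Implicit Arguments.
Unset Strict Implicit.
Unset Printing Implicit Defensive.

Import Order.TTheory GRing.Theory Num.Theory.
Import numFieldNormedType.Exports.

Local Open Scope classical_set_scope.
Local Open Scope ring_scope.

(* For p = 0, powR uses the convention 0 `^ 0 = 1; the exponent 0 is then always
   admissible, as it also is under the convention 0 ^ 0 = 0. *)
Definition roundness_exponent (R : realType) (X : metricType R) (p : R) : Prop :=
  forall n : nat, (2 <= n)%N -> forall x y : 'I_n -> X,
    \sum_(i < n) \sum_(j < n | (i < j)%N)
        (mdist (x i) (x j) `^ p + mdist (y i) (y j) `^ p)
    <= \sum_(i < n) \sum_(j < n) mdist (x i) (y j) `^ p.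

Definition generalized_roundness (R : realType) (X : metricType R) : \bar R :=
  ereal_sup [set p%:E | p in [set p : R | 0 <= p /\ roundness_exponent X p]].

Definition uniform_equivalence (R : realType) (X Y : metricType R)
    (f : X -> Y) : Prop :=
  exists g : Y -> X,
    [/\ cancel f g, cancel g f, unif_continuous f & unif_continuous g].

(* A non-decreasing function [0, +oo[ -> [0, +oo[ is given by a total function
   on R, of which only the values on [0, +oo[ are constrained. *)
Definition control_function (R : realType) (rho : R -> R) : Prop :=
  (forall t, 0 <= t -> 0 <= rho t) /\
  (forall s t, 0 <= s -> s <= t -> rho s <= rho t).

Definition coarse_embedding (R : realType) (X Y : metricType R)
    (f : X -> Y) : Prop :=
  exists rho1 rho2 : R -> R,
    [/\ control_function rho1, control_function rho2,
        forall x y : X, rho1 (mdist x y) <= mdist (f x) (f y)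
                        /\ mdist (f x) (f y) <= rho2 (mdist x y)
      & rho1 t @[t --> +oo] --> +oo].

Definition coarse_equivalence (R : realType) (X Y : metricType R)
    (f : X -> Y) : Prop :=
  coarse_embedding f /\
  exists C : R, 0 <= C /\ forall y : Y, exists x : X, mdist y (f x) <= C.

(* Main.v *)
(** Replacing the metric [d] by [d `^ 2^-1] doubles every roundness exponent,
    since [(d `^ 2^-1) `^ (2 * r) = d `^ r], while the identity map remains a
    uniform and coarse equivalence.  As the roundness [p] is positive, [X] has a
    roundness exponent [r > p / 2], and [2 * r > p] is one for the new metric. *)

Require Import Defs.
From HB Require Import structures.
From mathcomp Require Import all_boot all_order all_algebra.
From mathcomp Require Import all_classical all_reals all_analysis.

Set Implicit Arguments.
Unset Strict Implicit.
Unset Printing Implicit Defensive.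

Import Order.TTheory GRing.Theory Num.Theory.

Local Open Scope ring_scope.

(** Entourages of a metric space are generated by balls, and balls are cut out by [mdist], so the
    usual epsilon-delta criterion suffices. *)
Lemma unif_continuous_mdist (R : realType) (U V : metricType R) (f : U -> V) :
  (forall e : R, 0 < e -> exists2 d : R, 0 < d &
    forall x y, mdist x y < d -> mdist (f x) (f y) < e) ->
  unif_continuous f.
Proof.
move=> fP A; rewrite -!entourage_ballE => -[e /= e_gt0 eA].
have [d d_gt0 fd] := fP e e_gt0.
exists d => // -[x y]; rewrite /= ballEmdist/= => xy.
by apply: eA => /=; rewrite ballEmdist/=; apply: fd.
Qed.

(** A separate name for the carrier lets it bear a second metric, while [id] still serves as the map
    between the two spaces. *)
Definition sqrt_snowflake (R : realType) (X : metricType R) : Type := X.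

Section sqrt_snowflake_metric.
Variables (R : realType) (X : metricType R).

(** Only the choice structure is inherited; the uniformity will come from the new distance. *)
HB.instance Definition _ := Choice.on (sqrt_snowflake X).

Let dist (x y : sqrt_snowflake X) : R := Num.sqrt (mdist (x : X) (y : X)).

Let distxx x : dist x x = 0.
Proof. by rewrite /dist mdistxx sqrtr0. Qed.

Let dist_positivity x y : dist x y = 0 -> x = y.
Proof.
move/eqP; rewrite sqrtr_eq0 => d_le0.
by apply: mdist_positivity; apply/eqP; rewrite eq_le d_le0 mdist_ge0.
Qed.

Let dist_sym x y : dist x y = dist y x.
Proof. by rewrite /dist metric_sym. Qed.

Let dist_triangle y x z : dist x z <= dist x y + dist y z.
Proof.
(* After squaring, the right side is the old triangle bound plus a nonnegative cross term. *)
rewrite -(ler_pXn2r (n := 2)) ?nnegrE ?addr_ge0 ?sqrtr_ge0// sqrrD.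
rewrite !sqr_sqrtr ?mdist_ge0//.
apply: le_trans (metric_triangle _ (y : X) _) _.
by rewrite -addrA lerD2l lerDr mulrn_wge0// mulr_ge0// sqrtr_ge0.
Qed.

HB.instance Definition _ := isMetric.Build R (sqrt_snowflake X)
  distxx dist_positivity dist_sym dist_triangle.

End sqrt_snowflake_metric.

Section sqrt_snowflake_theory.
Variables (R : realType) (X : metricType R).
Local Notation Y := (sqrt_snowflake X).

Lemma mdist_sqrt_snowflake (x y : X) :
  mdist (x : Y) (y : Y) = Num.sqrt (mdist x y).
Proof. by []. Qed.

Lemma powR_mdist_sqrt_snowflake (x y : X) (r : R) :
  mdist (x : Y) (y : Y) `^ (2 * r) = mdist x y `^ r.
Proof.
rewrite mdist_sqrt_snowflake -powR12_sqrt ?mdist_ge0// -powRrM mulrA.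
by rewrite mulVf ?mul1r.
Qed.

Lemma roundness_exponent_sqrt_snowflake (r : R) :
  roundness_exponent X r -> roundness_exponent Y (2 * r).
Proof.
move=> Xr n n_ge2 x y; have := Xr n n_ge2 x y.
under eq_bigr do under eq_bigr do rewrite -!powR_mdist_sqrt_snowflake.
move/le_trans; apply; apply: ler_sum => i _; apply: ler_sum => j _.
by rewrite powR_mdist_sqrt_snowflake.
Qed.

Lemma generalized_roundness_sqrt_snowflake_gt (p : R) : 0 < p ->
  generalized_roundness X = p%:E -> (p%:E < generalized_roundness Y)%E.
Proof.
move=> p_gt0 Xp.
(* The strict inequality, where [0 < p] enters, yields an admissible exponent above [p / 2] even if
   the supremum is not attained. *)
have : ((p / 2)%:E < generalized_roundness X)%E.
  by rewrite Xp lte_fin ltr_pdivrMr// ltr_pMr// ltr1n.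
case/ereal_sup_gt => _ [r [r_ge0 Xr] <-]; rewrite lte_fin => pr.
apply: (@lt_le_trans _ _ (2 * r)%:E).
  by rewrite lte_fin mulrC -ltr_pdivrMr.
apply: ereal_sup_ubound; exists (2 * r) => //; split; first exact: mulr_ge0.
exact: roundness_exponent_sqrt_snowflake.
Qed.

Lemma uniform_equivalence_sqrt_snowflake :
  uniform_equivalence (id : X -> Y).
Proof.
exists id; split=> //; apply: unif_continuous_mdist => e e_gt0.
  (* A distance below [e ^+ 2] has square root below [e]; for the inverse map, [Num.sqrt e] is the
     matching modulus. *)
  exists (e ^+ 2) => [|x y xy]; first exact: exprn_gt0.
  rewrite mdist_sqrt_snowflake -(gtr0_norm e_gt0) -sqrtr_sqr.
  by rewrite ltr_sqrt// exprn_gt0.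
exists (Num.sqrt e) => [|x y]; first by rewrite sqrtr_gt0.
by rewrite mdist_sqrt_snowflake ltr_sqrt.
Qed.

Lemma coarse_equivalence_sqrt_snowflake :
  coarse_equivalence (id : X -> Y).
Proof.
split; last by exists 0; split=> // y; exists y; rewrite mdistxx.
(* The new distance is exactly the square root of the old one, so one function controls both
   sides. *)
exists Num.sqrt, Num.sqrt; split=> //.
- by split=> [t _|s t _ st]; [exact: sqrtr_ge0 | exact: ler_wsqrtr].
- by split=> [t _|s t _ st]; [exact: sqrtr_ge0 | exact: ler_wsqrtr].
apply/cvgryPge => A; near=> t.
(* The threshold is [A ^+ 2 <= t]; passing through the absolute value of [A] covers negative [A]. *)
apply: le_trans (ler_norm A) _; rewrite -sqrtr_sqr ler_wsqrtr//.
Unshelve. all: by end_near. Qed.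

End sqrt_snowflake_theory.

Theorem mainTheorem8 (R : realType) (X : metricType R) (p : R) (p_gt0 : 0 < p)
    (Xp : generalized_roundness X = p%:E) :
  exists (Y : metricType R) (q : \bar R),
    [/\ generalized_roundness Y = q, (p%:E < q)%E,
        exists f : X -> Y, uniform_equivalence f
      & exists f : X -> Y, coarse_equivalence f].
Proof.
(* The value [q] is bounded below strictly without being computed. *)
exists (sqrt_snowflake X), (generalized_roundness (sqrt_snowflake X)).
split=> //; first exact: generalized_roundness_sqrt_snowflake_gt.
  by exists id; exact: uniform_equivalence_sqrt_snowflake.
by exists id; exact: coarse_equivalence_sqrt_snowflake.
Qed.
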